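(* Let $\mathcal F$ be a class of Kripke frames over a finite alphabet $\mathrm{Al}$ and $L=\mathrm{Log}\,\mathcal F$ its logic. Then $\mathrm{md}(L)\le \mathrm{md}(\mathcal F)+\mathrm{tra}(\mathcal F)+1$ (with $\omega+n=n+\omega=\omega$).
   Context: Kripke frame $F=(X,(R_\Diamond)_{\Diamond\in\mathrm{Al}})$; $\mathrm{Log}\,\mathcal F$ is the set of formulas valid in all frames of $\mathcal F$. $R_F=\bigcup_\Diamond R_\Diamond$; $F$ is $m$-transitive if $R_F^{m+1}\subseteq\bigcup_{i\le m}R_F^i$; $\mathrm{tra}(\mathcal F)$ is the least $m$ with every frame of $\mathcal F$ $m$-transitive ($\omega$ if none). Modal depth of frames: for $\mathcal V\subseteq\mathcal P(X)$, $a\equiv_{\mathcal V}b$ iff $\forall V\in\mathcal V\,(a\in V\Leftrightarrow b\in V)$; $\sim_{\mathcal V,0}=\equiv_{\mathcal V}$, $\mathcal V_0=X/{\sim_{\mathcal V,0}}$; for $d\ge1$, $\sim_{\mathcal V,d}$ is induced by $\mathcal V_{d-1}\cup\{R_\Diamond^{-1}[V]:\Diamond\in\mathrm{Al},V\in\mathcal V_{d-1}\}$, $\mathcal V_d=X/{\sim_{\mathcal V,d}}$, $\mathcal V_\omega=\bigcup_d\mathcal V_d$; $\mathrm{md}(V)=\min\{d:V\in\mathcal V_d\}$; $\mathrm{md}(\mathcal V)=\sup_{V\in\mathcal V_\omega}\mathrm{md}(V)$; $\mathrm{md}(F)=\sup\{\mathrm{md}(\mathcal V):\mathcal V\subseteq\mathcal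 P(X)$ finite$\}$; $\mathrm{md}(\mathcal F)=\sup_{F\in\mathcal F}\mathrm{md}(F)$. Modal depth of a logic: $\mathrm{md}(\varphi)$ is the maximal modal nesting; $\mathrm{md}_L(\varphi)=\min\{\mathrm{md}(\psi):\varphi\leftrightarrow\psi\in L\}$; $\mathrm{md}(L)=\sup_\varphi\mathrm{md}_L(\varphi)$. *)

(* Defs.v *)
From mathcomp Require Import all_boot.
From mathcomp Require Import boolp classical_sets functions cardinality.

Set Implicit Arguments.
Unset Strict Implicit.
Unset Printing Implicit Defensive.

Local Open Scope classical_set_scope.

(* The ordinals up to omega, with omega absorbing for addition. *)
Inductive natw : Type := Fin of nat | Omega.

Definition lew (x y : natw) : Prop :=
  match x, y with
  | _, Omega => True
  | Omega, Fin _ => False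
  | Fin m, Fin n => (m <= n)%N
  end.

Definition addw (x y : natw) : natw :=
  match x, y with
  | Fin m, Fin n => Fin (m + n)
  | _, _ => Omega
  end.

(* Least element of a set of natural numbers, Omega if the set is empty. *)
Definition minw (A : set nat) : natw :=
  match pselect (exists n, `[< A n >]) with
  | left exA => Fin (ex_minn exA)
  | right _ => Omega
  end.

(* Least upper bound: the least finite upper bound, Omega if there is none;
   see supw_ub and supw_least. *)
Definition supw (A : set natw) : natw :=
  minw [set n | forall x, A x -> lew x (Fin n)].

Lemma supw_ub (A : set natw) (x : natw) : A x -> lew x (supw A).
Proof.
rewrite /supw /minw; case: pselect => [exA|_]; last by case: x.
by case: ex_minnP => m /asboolP ubm _; apply: ubm.
Qed.

Lemma supw_least (A : set natw) (y : natw) :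
  (forall x, A x -> lew x y) -> lew (supw A) y.
Proof.
case: y => [n|] ubA; last by case: (supw A).
rewrite /supw /minw; case: pselect => [exA|[]]; last by exists n; apply/asboolP.
by case: ex_minnP => m _; apply; apply/asboolP.
Qed.

Section Formulas.
Variable Al : finType.

Inductive form : Type :=
| Var of nat
| Bot
| Imp of form & form
| Dia of Al & form.

Definition And (p q : form) : form := Imp (Imp p (Imp q Bot)) Bot.
Definition Iff (p q : form) : form := And (Imp p q) (Imp q p).

Fixpoint depth (p : form) : nat :=
  match p with
  | Var _ => 0
  | Bot => 0
  | Imp q r => maxn (depth q) (depth r)
  | Dia _ q => (depth q).+1
  end.

Definition md_form (L : set form) (p : form) : natw :=
  minw [set depth q | q in [set q | L (Iff p q)]].

Definition md_logic (L : set form) : natw :=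
  supw [set md_form L p | p in setT].

Record frame : Type := Frame {
  world : Type;
  acc : Al -> world -> world -> Prop }.

Fixpoint forces (F : frame) (v : nat -> set (world F)) (p : form)
    (x : world F) : Prop :=
  match p with
  | Var n => v n x
  | Bot => False
  | Imp q r => forces v q x -> forces v r x
  | Dia a q => exists y, acc a x y /\ forces v q y
  end.

Definition valid (F : frame) (p : form) : Prop :=
  forall (v : nat -> set (world F)) (x : world F), forces v p x.

Definition Log (Fs : set frame) : set form :=
  [set p | forall F, Fs F -> valid F p].

Definition accU (F : frame) (x y : world F) : Prop := exists a, acc a x y.

Fixpoint relpow (X : Type) (r : X -> X -> Prop) (n : nat) (x y : X) : Prop :=
  match n with
  | 0 => x = y
  | n'.+1 => exists z, r x z /\ relpow r n' z y
  end.

Definition transitive_upto (m : nat) (F : frame) : Prop :=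
  forall x y : world F, relpow (@accU F) m.+1 x y ->
    exists2 i, (i <= m)%N & relpow (@accU F) i x y.

Definition tra (Fs : set frame) : natw :=
  minw [set m | forall F, Fs F -> transitive_upto m F].

Definition indist (X : Type) (V : set (set X)) (a b : X) : Prop :=
  forall A, V A -> (A a <-> A b).

(* The quotient of X by an equivalence relation, as a set of classes. *)
Definition quot (X : Type) (e : X -> X -> Prop) : set (set X) :=
  [set [set b | e a b] | a in setT].

Definition acc_preim (F : frame) (a : Al) (A : set (world F)) : set (world F) :=
  [set x | exists2 y, A y & acc a x y].

Fixpoint stage (F : frame) (V : set (set (world F))) (d : nat) :
    set (set (world F)) :=
  match d with
  | 0 => quot (indist V)
  | d'.+1 => quot (indist (stage V d' `|`
                [set B | exists a A, stage V d' A /\ B = acc_preim a A]))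
  end.

Definition stage_omega (F : frame) (V : set (set (world F))) :
    set (set (world F)) :=
  \bigcup_d stage V d.

Definition md_set (F : frame) (V : set (set (world F))) (A : set (world F)) :
    natw :=
  minw [set d | stage V d A].

Definition md_family (F : frame) (V : set (set (world F))) : natw :=
  supw [set md_set V A | A in stage_omega V].

Definition md_frame (F : frame) : natw :=
  supw [set md_family V | V in [set V : set (set (world F)) | finite_set V]].

Definition md_class (Fs : set frame) : natw :=
  supw [set md_frame F | F in Fs].

End Formulas.

(* Main.v *)
(* Only finitely many properties of pointed models are expressible by formulas
   of depth at most d in k variables, so each k-variable d-type is defined by
   one formula of depth d.  In a single model, the relation ~_d attached to the
   values of the k variables is equality of d-types; hence if D = md(F), then in
   every model over the class, points of equal D-type have equal (D+1)-type.
   Let x, x' be points of two such models with the same (D+T+1)-type, where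
   T = tra(F).  Every point y reachable from x is reachable in at most T steps,
   so some y'' reachable from x' has the same (D+1)-type as y.  If y' is any
   point reachable from x' with the D-type of y, then y' and y'' have the same
   D-type, hence the same (D+1)-type, so y and y' have the same (D+1)-type.
   Thus equality of D-types is a bisimulation between the submodels generated
   by x and x', and the truth of a formula at x is determined by the
   (D+T+1)-type of x. *)
Require Import Defs.
From Stdlib Require List.
From mathcomp Require Import all_boot.
From mathcomp Require Import boolp classical_sets functions cardinality.

Set Implicit Arguments.
Unset Strict Implicit.
Unset Printing Implicit Defensive.

Local Open Scope classical_set_scope.

(** * Bounds by minima, and powers of a relation *)

Lemma minw_le (A : set nat) n : A n -> lew (minw A) (Fin n).
Proof.
rewrite /minw => An; case: pselect => [exA|[]]; last by exists n; apply/asboolP.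
by case: ex_minnP => m _; apply; apply/asboolP.
Qed.

Lemma minw_Fin (A : set nat) n : lew (minw A) (Fin n) ->
  exists2 m, (m <= n)%N & A m.
Proof.
rewrite /minw; case: pselect => // exA.
by case: ex_minnP => m /asboolP Am _ le_mn; exists m.
Qed.

Lemma minw_eq_Fin (A : set nat) n : minw A = Fin n -> A n.
Proof.
by rewrite /minw; case: pselect => // exA; case: ex_minnP => m /asboolP Am _ [<-].
Qed.

Lemma lew_trans (y x z : natw) : lew x y -> lew y z -> lew x z.
Proof. by case: x y z => [m|] [n|] [p|] //=; apply: leq_trans. Qed.

Lemma mem_In (T : eqType) (x : T) (s : seq T) : x \in s -> List.In x s.
Proof.
elim: s => //= y s IHs; rewrite inE => /orP[/eqP ->|/IHs ?]; first by left.
by right.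
Qed.

Lemma relpow_rcons (X : Type) (r : X -> X -> Prop) n x y z :
  relpow r n x y -> r y z -> relpow r n.+1 x z.
Proof.
elim: n x => [x -> ryz|n IHn x [u [rxu ruy]] ryz]; first by exists z.
by exists u; split=> //; apply: IHn ryz.
Qed.

(** * State descriptions over a finite list of formulas *)

Section Types.
Variable Al : finType.
Implicit Types (F G H : frame Al) (p q c : form Al) (l : seq (form Al)).

Lemma forces_And F (v : nat -> set (world F)) p q x :
  forces v (And p q) x <-> forces v p x /\ forces v q x.
Proof.
split=> /= [npq|[hp hq] npq]; last exact: npq.
by split; apply: contrapT => hn; apply: npq.
Qed.

Definition agree l F G (v : nat -> set (world F)) (w : nat -> set (world G))
    (x : world F) (y : world G) : Prop :=
  forall p, List.In p l -> (forces v p x <-> forces w p y).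

Lemma agree_refl l F (v : nat -> set (world F)) x : agree l v v x x.
Proof. by []. Qed.

Lemma agree_sym l F G (v : nat -> set (world F)) (w : nat -> set (world G)) x y :
  agree l v w x y -> agree l w v y x.
Proof. by move=> xy p /xy []. Qed.

Lemma agree_trans l F G H (u : nat -> set (world F)) (v : nat -> set (world G))
    (w : nat -> set (world H)) x y z :
  agree l u v x y -> agree l v w y z -> agree l u w x z.
Proof. by move=> xy yz p lp; rewrite (xy p lp); apply: yz. Qed.

(** One conjunction per choice of signs on [l], closed off by a tautology; unsatisfiable choices are
    kept. *)
Fixpoint atoms l : seq (form Al) :=
  match l with
  | [::] => [:: Imp (Bot Al) (Bot Al)]
  | p :: l' => map (And p) (atoms l') ++ map (And (Imp p (Bot Al))) (atoms l')
  end.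

Lemma atoms_cover l F (v : nat -> set (world F)) x :
  exists2 c, List.In c (atoms l) & forces v c x.
Proof.
elim: l => [|p l [c lc cx]] /=.
  by exists (Imp (Bot Al) (Bot Al)) => //; left.
case: (pselect (forces v p x)) => px.
  exists (And p c); last by apply/forces_And.
  by apply/List.in_app_iff; left; apply/List.in_map_iff; exists c.
exists (And (Imp p (Bot Al)) c); last by apply/forces_And.
by apply/List.in_app_iff; right; apply/List.in_map_iff; exists c.
Qed.

(** Truth of [c] at [x] forces its signs to be the truth values at [x], so [c] defines the agreement
    class of [x] in all models at once. *)
Lemma atoms_agree l F G (v : nat -> set (world F)) (w : nat -> set (world G))
    c x y :
  List.In c (atoms l) -> forces v c x -> (forces w c y <-> agree l v w x y).
Proof.
elim: l c => [|p l IHl] c /=; first by case=> // <- _; split=> // _.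
move=> /List.in_app_iff[] /List.in_map_iff[c' [<- lc']] /forces_And[px cx];
  rewrite forces_And (IHl c' lc' cx); split.
- by move=> [py xy] q [<-|/xy].
- by move=> xy; split=> [|q lq]; [apply/(xy p (or_introl erefl))|apply: xy; right].
- by move=> [py xy] q [<-|/xy //]; split=> [/px|/py].
- move=> xy; split=> [py|q lq]; last by apply: xy; right.
  by apply/px/(xy p (or_introl erefl)).
Qed.

Lemma atoms_depth n l : (forall p, List.In p l -> (depth p <= n)%N) ->
  forall c, List.In c (atoms l) -> (depth c <= n)%N.
Proof.
elim: l => [_ c /= [<-|] //|p l IHl ln c /=].
have {}IHl := IHl (fun q lq => ln q (or_intror lq)).
have pn := ln p (or_introl erefl).
by move=> /List.in_app_iff[] /List.in_map_iff[c' [<- /IHl c'n]] /=;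
  rewrite ?geq_max ?maxn0 ?pn ?c'n.
Qed.

(** A finite disjunction; [P] is an arbitrary proposition, so excluded middle decides which members
    enter it, once for all models. *)
Lemma definable_union n l (P : form Al -> Prop) :
  (forall p, List.In p l -> (depth p <= n)%N) ->
  exists2 q, (depth q <= n)%N &
    forall F (v : nat -> set (world F)) x,
      forces v q x <-> exists p, [/\ List.In p l, P p & forces v p x].
Proof.
elim: l => [_|p l IHl ln].
  by exists (Bot Al) => // F v x; split=> // -[p []].
have [q qn qE] := IHl (fun q lq => ln q (or_intror lq)).
case: (pselect (P p)) => Pp.
  exists (Imp (Imp p (Bot Al)) q).
    by rewrite /= maxn0 geq_max qn (ln p (or_introl erefl)).
  move=> F v x; split=> /=.
    move=> npq; case: (pselect (forces v p x)) => [px|/npq /qE].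
      by exists p; split=> //; left.
    by move=> [r [lr Pr rx]]; exists r; split=> //; right.
  move=> [r [[<- Pr rx /(_ rx) []|lr Pr rx _]]].
  by apply/qE; exists r.
exists q => // F v x; rewrite qE; split=> -[r [lr Pr rx]].
  by exists r; split=> //; right.
by case: lr => [pr|lr]; [case: Pp; rewrite pr|exists r].
Qed.

(** * Types of bounded depth *)

(** Agreement on [basis k d] is equality of [d]-types in [k] variables: it suffices to test diamonds
    of the state descriptions of the previous level, since each satisfiable one isolates a single
    type. *)
Fixpoint basis k d : seq (form Al) :=
  match d with
  | 0 => map (@Var Al) (iota 0 k)
  | d'.+1 => basis k d' ++
      List.flat_map (fun a => map (Dia a) (atoms (basis k d'))) (enum Al)
  end.

Lemma In_basis_Var k i : List.In (Var Al i) (basis k 0) <-> (i < k)%N.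
Proof.
split=> [/List.in_map_iff[j [[->]]]|ik].
  have: forall s : seq nat, List.In i s -> i \in s.
    by elim=> //= y s IHs [->|/IHs si]; rewrite inE ?eqxx ?si ?orbT.
  by move=> /[apply]; rewrite mem_iota.
by apply/List.in_map_iff; exists i; split=> //; apply: mem_In; rewrite mem_iota.
Qed.

Lemma In_basisS k d p : List.In p (basis k d.+1) <->
  List.In p (basis k d) \/
  exists a c, List.In c (atoms (basis k d)) /\ p = Dia a c.
Proof.
rewrite /= List.in_app_iff List.in_flat_map; split=> -[lp|]; try by left.
  move=> [a [_ /List.in_map_iff[c [<- lc]]]].
  by right; exists a, c.
move=> [a [c [lc ->]]]; right; exists a; split.
  by apply: mem_In; rewrite mem_enum.
by apply/List.in_map_iff; exists c.
Qed.

Lemma basis_mono k d e p :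
  (d <= e)%N -> List.In p (basis k d) -> List.In p (basis k e).
Proof.
move=> /subnK <- lp; elim: (e - d)%N => // n IHn.
by rewrite addSn; apply/In_basisS; left.
Qed.

Lemma agree_mono k d e F G (v : nat -> set (world F)) (w : nat -> set (world G))
    x y :
  (d <= e)%N -> agree (basis k e) v w x y -> agree (basis k d) v w x y.
Proof. by move=> de xy p lp; apply: xy; apply: basis_mono lp. Qed.

Lemma basis_depth k d p : List.In p (basis k d) -> (depth p <= d)%N.
Proof.
elim: d p => [|d IHd] p; first by move=> /List.in_map_iff[i [<-]].
move=> /In_basisS[/IHd /leqW //|[a [c [lc ->]]]].
exact: (atoms_depth IHd lc).
Qed.

(** The state description of [x'], put under a diamond, is itself tested at level [d.+1]. *)
Lemma agree_forth k d F G (v : nat -> set (world F)) (w : nat -> set (world G))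
    x y a x' :
  agree (basis k d.+1) v w x y -> acc a x x' ->
  exists2 y', acc a y y' & agree (basis k d) v w x' y'.
Proof.
move=> xy ax; have [c lc cx'] := atoms_cover (basis k d) v x'.
have /xy[+ _] : List.In (Dia a c) (basis k d.+1).
  by apply/In_basisS; right; exists a, c.
case=> [|y' [ay cy']]; first by exists x'.
by exists y' => //; apply/(atoms_agree _ _ lc cx').
Qed.

Lemma agree_relpow k d n F G (v : nat -> set (world F))
    (w : nat -> set (world G)) x y x' :
  agree (basis k (d + n)) v w x y -> relpow (@accU _ F) n x x' ->
  exists2 y', relpow (@accU _ G) n y y' & agree (basis k d) v w x' y'.
Proof.
elim: n x y => [|n IHn] x y; first by rewrite addn0 => xy /= <-; exists y.
rewrite addnS => xy [z [[a xz] zx']].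
have [t yt /IHn] := agree_forth xy xz.
by move=> /(_ zx') [y' ty' x'y']; exists y' => //; exists t; split=> //; exists a.
Qed.

(** * Stages of a frame as partitions into types *)

Lemma eq_quot (X : Type) (e e' : X -> X -> Prop) :
  (forall x y, e x y <-> e' x y) -> quot e = quot e'.
Proof.
move=> ee'; suff -> : e = e' by [].
by apply/funext => x; apply/funext => y; apply/propext.
Qed.

(** The classes of level [d] are the nonempty truth sets of state descriptions, so their preimages
    are truth sets of diamonds. *)
Lemma stageE k d F (v : nat -> set (world F)) :
  stage [set v i | i in `I_k] d = quot (agree (basis k d) v v).
Proof.
elim: d => [|d IHd] /=; apply: eq_quot => x y.
  split=> [xy p lp|xy A [i ik <-]].
    have /List.in_map_iff[i [pi _]] := lp.
    move: lp; rewrite -pi => /In_basis_Var ik.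
    by apply: xy; exists i.
  by apply: (xy (Var Al i)); apply/In_basis_Var.
rewrite IHd; set W := (W in indist W).
split=> [xy p /In_basisS[lp|[a [c [lc ->]]]]|xy A [[z _ <-]|]].
- have Wx : W [set b | agree (basis k d) v v x b] by left; exists x.
  exact: (xy _ Wx).1 (@agree_refl _ _ _ _) p lp.
(* If [c] holds nowhere in the model, its diamond fails at both points; otherwise [c] defines the
   class of any [z] forcing it. *)
- have [[z cz]|nc] := pselect (exists z, forces v c z); last first.
    by split=> -[z [_ cz]]; case: nc; exists z.
  pose B := acc_preim a [set b | agree (basis k d) v v z b].
  have WB : W B.
    by right; exists a, [set b | agree (basis k d) v v z b]; split=> //; exists z.
  have E t : B t <-> forces v (Dia a c) t.
    split=> [[u /(atoms_agree _ _ lc cz) cu tu]|[u [tu cu]]]; exists u => //.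
    by apply/(atoms_agree _ _ lc cz).
  by rewrite -!E; apply: xy.
- have xyd := agree_mono (leqnSn d) xy.
  by split=> zb; apply: agree_trans zb _ => //; apply: agree_sym.
- move=> [a [B [[z _ <-] ->]]].
  split=> -[u zu au].
    have [t yt ut] := agree_forth xy au.
    by exists t => //; apply: agree_trans zu ut.
  have [t yt ut] := agree_forth (agree_sym xy) au.
  by exists t => //; apply: agree_trans zu ut.
Qed.

(** The class of [x] at level [D.+1] has modal depth at most [D], so it is already a class of some
    level [d <= D] and is closed under agreement at level [D]. *)
Lemma md_frame_agree k D F (v : nat -> set (world F)) x y :
  lew (md_frame F) (Fin D) ->
  agree (basis k D) v v x y -> agree (basis k D.+1) v v x y.
Proof.
move=> FD xy; set V := [set v i | i in `I_k].
pose A := [set b | agree (basis k D.+1) v v x b].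
have VA : stage V D.+1 A by rewrite stageE; exists x.
have VF : lew (md_family V) (md_frame F).
  by apply: supw_ub; exists V => //; apply: finite_image; apply: finite_II.
have AV : lew (md_set V A) (md_family V).
  by apply: supw_ub; exists A => //; exists D.+1.
have [d dD] := minw_Fin (lew_trans AV (lew_trans VF FD)).
rewrite /= stageE => -[z _ zA].
have Ax : A x by [].
have -> : agree (basis k D.+1) v v x y = A y by [].
rewrite -zA; apply: agree_trans (agree_mono dD xy).
by move: Ax; rewrite -zA.
Qed.

(** * Bisimulation between generated submodels *)

Fixpoint nvars p : nat :=
  match p with
  | Var n => n.+1
  | Bot => 0
  | Imp q r => maxn (nvars q) (nvars r)
  | Dia _ q => nvars q
  end.

(** Under [transitive_upto T F], this is membership in the submodel generated by [x]. *)
Definition near F T (x y : world F) : Prop :=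
  exists2 i, (i <= T)%N & relpow (@accU _ F) i x y.

Lemma near_step F T a (x y z : world F) :
  transitive_upto T F -> near T x y -> acc a y z -> near T x z.
Proof.
move=> FT [i iT xy] yz; have xz : relpow (@accU _ F) i.+1 x z.
  by apply: relpow_rcons xy _; exists a.
move: iT; rewrite leq_eqVlt => /orP[/eqP iT|iT]; last by exists i.+1.
by apply: FT; rewrite -iT.
Qed.

Lemma agree_near_lift k D T F G (v : nat -> set (world F))
    (w : nat -> set (world G)) x0 y0 x y :
  lew (md_frame G) (Fin D) -> agree (basis k (D + T + 1)) v w x0 y0 ->
  near T x0 x -> agree (basis k D) v w x y -> agree (basis k D.+1) v w x y.
Proof.
move=> GD xy0 [i iT x0x] xy.
(* Walking to [x] spends [i <= T] of the [D + T + 1] levels and leaves [D.+1] at [z]; the points [y]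
   and [z] then lie in one model, where level [D] suffices. *)
have /agree_relpow/(_ x0x) [z _ xz] : agree (basis k (D.+1 + i)) v w x0 y0.
  by apply: agree_mono xy0; rewrite addn1 addSn ltnS leq_add2l.
apply: (agree_trans xz); apply: md_frame_agree GD _.
by apply: agree_trans xy; apply/agree_sym/(agree_mono (leqnSn D)).
Qed.

Lemma agree_forces k D T F G (v : nat -> set (world F))
    (w : nat -> set (world G)) x0 y0 :
  lew (md_frame F) (Fin D) -> lew (md_frame G) (Fin D) ->
  transitive_upto T F -> transitive_upto T G ->
  agree (basis k (D + T + 1)) v w x0 y0 ->
  forall p, (nvars p <= k)%N -> forall x y,
  near T x0 x -> near T y0 y -> agree (basis k D) v w x y ->
  (forces v p x <-> forces w p y).
Proof.
move=> FD GD FT GT xy0; elim=> [i|//|q IHq r IHr|a q IHq] /= pk x y x0x y0y xy.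
- by apply: (xy (Var Al i)); apply: (@basis_mono k 0) => //; apply/In_basis_Var.
- move: pk; rewrite geq_max => /andP[qk rk].
  by rewrite (IHq qk x y) // (IHr rk x y).
(* One lift serves both zigzag clauses; successors agree at level [D] again, so the induction loses
   no depth. *)
have xyS := agree_near_lift GD xy0 x0x xy.
split=> -[z [az qz]].
  have [t at_ zt] := agree_forth xyS az; exists t; split=> //.
  by apply/(IHq pk z t) => //; [apply: near_step az|apply: near_step at_].
have [t at_ zt] := agree_forth (agree_sym xyS) az; exists t; split=> //.
apply/(IHq pk t z) => //; [exact: near_step at_|exact: near_step az|].
exact: agree_sym.
Qed.

End Types.

Theorem theorem6p18 (Al : finType) (Fs : set (frame Al)) :
  lew (md_logic (Log Fs)) (addw (addw (md_class Fs) (tra Fs)) (Fin 1)).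
Proof.
case mdE: (md_class Fs) => [D|]; last by case: (md_logic _).
case traE: (tra Fs) => [T|]; last by case: (md_logic _).
have FsT F : Fs F -> transitive_upto T F := @minw_eq_Fin _ _ traE F.
have FsD F : Fs F -> lew (md_frame F) (Fin D).
  by move=> FsF; rewrite -mdE; apply: supw_ub; exists F.
apply: supw_least => _ [p _ <-] /=.
set N := (D + T + 1)%N; set k := nvars p.
(* The formula [q] is the disjunction of the state descriptions realised together with [p] at some
   point over the class. *)
have [q qN qE] := @definable_union _ N (atoms (basis Al k N))
  (fun c => exists F (v : nat -> set (world F)) x,
     [/\ Fs F, forces v c x & forces v p x])
  (atoms_depth (@basis_depth _ k N)).
apply: (@lew_trans (Fin (depth q))) => //; apply: minw_le; exists q => //= F FsF v x.
have pq : forces v p x <-> forces v q x.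
  rewrite qE; split=> [px|[c [lc [G [w [y [FsG cy py]]]] cx]]].
    have [c lc cx] := atoms_cover (basis Al k N) v x.
    by exists c; split=> //; exists F, v, x.
  have xy : agree (basis Al k N) v w x y by apply/(atoms_agree _ _ lc cx).
  have near0 H (z : world H) : near T z z by exists 0.
  apply/(agree_forces (FsD F FsF) (FsD G FsG) (FsT F FsF) (FsT G FsG) xy) => //.
  by apply: agree_mono xy; rewrite /N -addnA leq_addr.
by apply/forces_And; case: pq.
Qed.
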